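(* For every $n\ge1$ and every $k\ge0$, the symmetric function $g_k(P_n;x,q)$ of the path graph $P_n$ on $n$ vertices is $e$-positive, i.e. the coefficients of its expansion in the basis $(e_\lambda)$ of elementary symmetric functions are polynomials in $q$ with non-negative coefficients.
   Context: $[n]=\{1,\dots,n\}$. A Hessenberg function is a non-decreasing $\mathbf m\colon[n]\to[n]$ with $\mathbf m(i)\ge i$ for all $i$. $h_j,e_j$ are the complete homogeneous and elementary symmetric functions ($h_0=e_0=1$), $e_\lambda=\prod_ie_{\lambda_i}$, and $\omega$ is the $q$-linear involution with $\omega(h_j)=e_j$. With $[n]_q=1+q+\dots+q^{n-1}$, $\rho_n$ ($n\ge1$) is defined recursively by $[n]_qh_n=\sum_{i=0}^{n-1}h_i\rho_{n-i}$. $S_{n,\mathbf m}=\{\sigma\in S_n:\sigma(i)\le\mathbf m(i)\text{ for all }i\}$. Each $\sigma\in S_n$ is written as its cycle decomposition $\sigma=\tau_1\cdots\tau_j$ (fixed points included), each cycle beginning with its smallest element and cycles ordered increasingly by their smallest elements; $|\tau_i|$ is the length of $\tau_i$. $\sigma^c$ is the permutation whose one-line notation is obtained by erasing the parentheses. $\mathrm{wt}_{\mathbf m}(\sigma)$ is the number of pairs $(i,j)$ with $i<j\le\mathbf m(i)$ and $(\sigma^c)^{-1}(i)>(\sigma^c)^{-1}(j)$. For $k<n$, \[ g_k(\mathbf m;x,q):=\sum_{\substack{\sigma=\tau_1\cdots \tau_{j}\in S_{n,\mathbf m}\\ |\tau_1|\geq n-k}} (-1)^{|\tau_1|-n+k}q^{\mathrm{wt}_{\mathbf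 m}(\sigma)}h_{|\tau_1|-n+k}\,\omega(\rho_{|\tau_2|}\cdots \rho_{|\tau_j|}). \] The path graph $P_n$ corresponds to $\mathbf m(i)=\min(i+1,n)$, and $g_k(P_n;x,q)$ denotes $g_k$ of this Hessenberg function when $k<n$; for $k\ge n$ one defines $g_k(P_n;x,q):=g_k(P_N;x,q)$ for any $N>k$ (the value does not depend on $N$). *)

(* Defs.v *)
From HB Require Import structures.
From mathcomp Require Import all_boot all_order all_algebra all_fingroup.
From mathcomp Require Import boolp.
From mathcomp Require Import mpoly.

Set Implicit Arguments.
Unset Strict Implicit.
Unset Printing Implicit Defensive.

Import GRing.Theory Num.Theory.

Local Open Scope ring_scope.

(* The ring of symmetric functions over R in the variables x_0, x_1, ... is
   taken as the inverse limit, with bounded degree, of the rings of symmetric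
   polynomials in N variables (Macdonald, I.2): see [is_symfun]. *)

Section Restriction.
Variables (R : comNzRingType).

Definition restr_vars (N M : nat) : M.-tuple {mpoly R[N]} :=
  [tuple oapp (fun j : 'I_N => 'X_j) 0 (insub (i : nat)) | i < M].

(* Sets x_i = 0 for all i >= N; for M <= N this is the inclusion. *)
Definition restr (N M : nat) (p : {mpoly R[M]}) : {mpoly R[N]} :=
  p \mPo restr_vars N M.

HB.instance Definition _ N M :=
  GRing.RMorphism.copy (@restr N M) (comp_mpoly (restr_vars N M)).
HB.instance Definition _ N M :=
  GRing.Linear.copy (@restr N M) (comp_mpoly (restr_vars N M)).

Definition pad (N M : nat) (m : 'X_{1..N}) : 'X_{1..M} :=
  [multinom oapp (fun j : 'I_N => m j) 0%N (insub (i : nat)) | i < M].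

Lemma pad_lt N M (m : 'X_{1..N}) (i : 'I_M) (j : 'I_N) :
  i = j :> nat -> pad M m i = m j.
Proof.
by move=> ij; rewrite mnmE ij insubT //= => ltjN; rewrite (_ : Sub _ _ = j) //; apply/val_inj.
Qed.

Lemma pad_ge N M (m : 'X_{1..N}) (i : 'I_M) : (N <= i)%N -> pad M m i = 0%N.
Proof. by move=> le_Ni; rewrite mnmE insubF //= ltnNge le_Ni. Qed.

Lemma padK N M (m : 'X_{1..M}) : (forall i : 'I_M, (N <= i)%N -> m i = 0%N) ->
  (N <= M)%N -> pad M (pad N m) = m.
Proof.
move=> m0 leNM; apply/mnmP=> i; case: (ltnP i N) => [lt|ge].
  by rewrite (pad_lt _ (j := Ordinal lt)) // (pad_lt _ (j := i)).
by rewrite pad_ge ?m0.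
Qed.

Lemma padK2 N M (m : 'X_{1..N}) : (N <= M)%N -> pad N (pad M m) = m.
Proof.
move=> leNM; apply/mnmP=> i.
by rewrite (pad_lt _ (j := widen_ord leNM i)) // (pad_lt _ (j := i)).
Qed.

Lemma mdeg_pad N M (m : 'X_{1..N}) : (N <= M)%N -> mdeg (pad M m) = mdeg m.
Proof.
move=> leNM; rewrite !mdegE (bigID (fun i : 'I_M => (i < N)%N)) /=.
rewrite [X in (_ + X)%N]big1 => [|i]; last by rewrite -leqNgt => /pad_ge ->.
rewrite addn0 (big_ord_narrow leNM) /=.
by apply: eq_bigr => i _; apply: pad_lt.
Qed.

Lemma restrX_in N M (m : 'X_{1..M}) :
  (forall i : 'I_M, (N <= i)%N -> m i = 0%N) -> (N <= M)%N ->
  restr N 'X_[m] = 'X_[pad N m].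
Proof.
move=> m0 leNM; rewrite /restr comp_mpolyX.
rewrite (bigID (fun i : 'I_M => (i < N)%N)) /=.
rewrite [X in _ * X]big1 ?mulr1 => [|i]; last first.
  by rewrite -leqNgt => /m0 ->; rewrite expr0.
rewrite (big_ord_narrow leNM) [RHS]mpolyXE_id; apply: eq_bigr => i _.
rewrite tnth_mktuple /= insubT //= => lti.
by rewrite (pad_lt m (j := widen_ord leNM i)) //; congr ('X_ _ ^+ _); apply/val_inj.
Qed.

Lemma restrX_out N M (m : 'X_{1..M}) (i : 'I_M) :
  (N <= i)%N -> m i != 0%N -> restr N 'X_[m] = 0.
Proof.
move=> leNi mi; rewrite /restr comp_mpolyX (bigD1 i) //=.
by rewrite tnth_mktuple insubF ?ltnNge ?leNi //= expr0n (negPf mi) mul0r.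
Qed.

Arguments restr : simpl never.

Lemma restrZ N M a (p : {mpoly R[M]}) : restr N (a *: p) = a *: restr N p.
Proof. exact: comp_mpolyZ. Qed.

Lemma restrD N M (p q : {mpoly R[M]}) : restr N (p + q) = restr N p + restr N q.
Proof. exact: comp_mpolyD. Qed.

Lemma restrM N M (p q : {mpoly R[M]}) : restr N (p * q) = restr N p * restr N q.
Proof. exact: (rmorphM (@restr N M)). Qed.

Lemma restr_sum N M I r (P : pred I) (F : I -> {mpoly R[M]}) :
  restr N (\sum_(i <- r | P i) F i) = \sum_(i <- r | P i) restr N (F i).
Proof. exact: raddf_sum. Qed.

Lemma mcoeff_restr N M (p : {mpoly R[M]}) (m : 'X_{1..N}) : (N <= M)%N ->
  (restr N p)@_m = p@_(pad M m).
Proof.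
move=> leNM; rewrite {1}(mpolyE p) [in RHS](mpolyE p) restr_sum !raddf_sum /=.
apply: eq_bigr => m' _; rewrite restrZ !mcoeffZ; congr (_ * _).
have [/forallP m'0|/forallPn[i]] := boolP [forall i : 'I_M, (N <= i)%N ==> (m' i == 0%N)].
  have {}m'0 (i : 'I_M) : (N <= i)%N -> m' i = 0%N by move=> /(implyP (m'0 i))/eqP.
  rewrite restrX_in // !mcoeffX; congr (_%:R); congr nat_of_bool.
  by apply/eqP/eqP => E; [rewrite -E padK | rewrite E padK2].
rewrite negb_imply => /andP[leNi m'i]; rewrite (restrX_out leNi) // mcoeff0 mcoeffX.
case: eqP => // E; case/negP: m'i; apply/eqP.
by rewrite E pad_ge.
Qed.

End Restriction.

Section Family.
Variable (R : comNzRingType).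

Definition family_mpoly := forall N : nat, {mpoly R[N]}.
Implicit Types f g h : family_mpoly.

HB.instance Definition _ := Choice.on family_mpoly.

Lemma famP f g : (forall N, f N = g N) -> f = g.
Proof. exact: functional_extensionality_dep. Qed.

Definition fam0 : family_mpoly := fun N => 0.
Definition famN f : family_mpoly := fun N => - f N.
Definition famD f g : family_mpoly := fun N => f N + g N.

Fact famDA : associative famD.
Proof. by move=> f g h; apply: famP => N; rewrite /famD addrA. Qed.
Fact famDC : commutative famD.
Proof. by move=> f g; apply: famP => N; rewrite /famD addrC. Qed.
Fact fam0D : left_id fam0 famD.
Proof. by move=> f; apply: famP => N; rewrite /famD add0r. Qed.
Fact famND : left_inverse fam0 famN famD.
Proof. by move=> f; apply: famP => N; rewrite /famD addNr. Qed.

HB.instance Definition _ :=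
  GRing.isZmodule.Build family_mpoly famDA famDC fam0D famND.

Definition fam1 : family_mpoly := fun N => 1.
Definition famM f g : family_mpoly := fun N => f N * g N.

Fact famMA : associative famM.
Proof. by move=> f g h; apply: famP => N; rewrite /famM mulrA. Qed.
Fact famMC : commutative famM.
Proof. by move=> f g; apply: famP => N; rewrite /famM mulrC. Qed.
Fact fam1M : left_id fam1 famM.
Proof. by move=> f; apply: famP => N; rewrite /famM mul1r. Qed.
Fact famMDl : left_distributive famM famD.
Proof. by move=> f g h; apply: famP => N; rewrite /famM mulrDl. Qed.
Fact fam1_neq0 : fam1 != 0.
Proof. by apply/eqP => /(congr1 (fun f => f 0%N)) /eqP; rewrite oner_eq0. Qed.

HB.instance Definition _ :=
  GRing.Zmodule_isComNzRing.Build family_mpoly famMA famMC fam1M famMDl fam1_neq0.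

Definition famZ (a : R) f : family_mpoly := fun N => a *: f N.

Fact famZA a b f : famZ a (famZ b f) = famZ (a * b) f.
Proof. by apply: famP => N; rewrite /famZ scalerA. Qed.
Fact fam1Z : left_id 1 famZ.
Proof. by move=> f; apply: famP => N; rewrite /famZ scale1r. Qed.
Fact famZDr : right_distributive famZ famD.
Proof. by move=> a f g; apply: famP => N; rewrite /famZ scalerDr. Qed.
Fact famZDl f : {morph famZ^~ f : a b / a + b}.
Proof. by move=> a b; apply: famP => N; rewrite /famZ scalerDl. Qed.

HB.instance Definition _ :=
  GRing.Zmodule_isLmodule.Build R family_mpoly famZA fam1Z famZDr famZDl.

Fact famZAl (a : R) f g : a *: (f * g) = (a *: f) * g.
Proof. by apply: famP => N; apply: scalerAl. Qed.

HB.instance Definition _ := GRing.Lmodule_isLalgebra.Build R family_mpoly famZAl.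
HB.instance Definition _ := GRing.Lalgebra_isComAlgebra.Build R family_mpoly.

Definition is_symfun : {pred family_mpoly} := fun f =>
  `[< [/\ forall N, f N \is symmetric,
          forall N M, (N <= M)%N -> restr N (f M) = f N
        & exists d, forall N, (msize (f N) <= d)%N] >].

Fact is_symfun_subalg : subalg_closed is_symfun.
Proof.
have DZ a f g N : (a *: f + g) N = a *: f N + g N by [].
have MN f g N : (f * g) N = f N * g N by [].
split=> [|a f g /asboolP[fs fr [d fd]] /asboolP[gs gr [e ge]]
         |f g /asboolP[fs fr [d fd]] /asboolP[gs gr [e ge]]]; apply/asboolP; split.
- by move=> N; apply: rpred1.
- by move=> N M _; apply: rmorph1.
- by exists 1%N => N; rewrite msize1.
- by move=> N; rewrite DZ; apply/issymP => s; rewrite msymD msymZ; congr (_ *: _ + _); apply/issymP.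
- by move=> N M leNM; rewrite !DZ restrD restrZ fr ?gr.
- exists (maxn d e) => N; rewrite DZ; apply: leq_trans (msizeD_le _ _) _.
  by rewrite geq_max !leq_max ge orbT (leq_trans (msizeZ_le _ _) (fd N)).
- by move=> N; rewrite MN; apply/issymP => s; rewrite msymM; congr (_ * _); apply/issymP.
- by move=> N M leNM; rewrite !MN restrM fr ?gr.
- exists (d + e).+1%N => N; rewrite MN; apply: leq_trans (msizeM_le _ _) _.
  by rewrite ltnS leq_add.
Qed.

HB.instance Definition _ :=
  GRing.isSubalgClosed.Build R family_mpoly is_symfun is_symfun_subalg.

Record symfun := SymFun { components : family_mpoly; _ : components \in is_symfun }.

HB.instance Definition _ := [isSub for components].
HB.instance Definition _ := [Choice of symfun by <:].
HB.instance Definition _ := [SubChoice_isSubAlgebra of symfun by <:].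
HB.instance Definition _ := [SubNzRing_isSubComNzRing of symfun by <:].


End Family.

Section Generators.
Variable (R : comNzRingType).
Local Notation symfun := (symfun R).
Implicit Types f g : symfun.

Lemma symfunP f g : (forall N, components f N = components g N) -> f = g.
Proof. by move=> fg; apply/val_inj/famP. Qed.

Lemma msize_le_coeff N d (p : {mpoly R[N]}) :
  (forall m, p@_m != 0 -> (mdeg m <= d)%N) -> (msize p <= d.+1)%N.
Proof.
move=> pd; rewrite msizeE; apply/bigmax_leqP_seq => m.
by rewrite mcoeff_msupp => + _; apply: pd.
Qed.

Definition mhsym (N k : nat) : {mpoly R[N]} :=
  \sum_(m : 'X_{1..N < k.+1} | mdeg m == k) 'X_[m].

Lemma mcoeff_mhsym N k m : (mhsym N k)@_m = (mdeg m == k)%:R.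
Proof.
rewrite /mhsym raddf_sum /=; have [mk|mk] := eqVneq (mdeg m) k; last first.
  rewrite big1 // => m' /eqP m'k; rewrite mcoeffX.
  by case: eqP => // E; rewrite -E m'k eqxx in mk.
have ltmk : (mdeg m < k.+1)%N by rewrite mk.
rewrite (bigD1 (BMultinom ltmk)) /= ?mk // mcoeffX eqxx big1 ?addr0 //.
move=> m' /andP[_ ne]; rewrite mcoeffX; case: eqP => // E.
by case/eqP: ne; apply/val_inj.
Qed.

Fact mhsym_is_symfun k : (fun N => mhsym N k) \in @is_symfun R.
Proof.
apply/asboolP; split=> [N|N M leNM|].
- apply/issymP => s; apply/mpolyP => m.
  by rewrite mcoeff_sym !mcoeff_mhsym mdeg_mperm.
- by apply/mpolyP => m; rewrite mcoeff_restr // !mcoeff_mhsym mdeg_pad.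
- exists k.+1 => N; apply: msize_le_coeff => m; rewrite mcoeff_mhsym.
  by case: (mdeg m =P k) => [->|]; rewrite ?leqnn ?eqxx.
Qed.

Fact mesym_is_symfun k : (fun N => mesym N R k) \in @is_symfun R.
Proof.
apply/asboolP; split=> [N|N M leNM|].
- exact: mesym_sym.
- apply/mpolyP => m; rewrite mcoeff_restr // !mcoeff_mesym; congr (_%:R).
  rewrite /mechar mdeg_pad //; congr (nat_of_bool (_ && _)).
  apply/forallP/forallP => m1 i.
    by rewrite -(pad_lt m (i := widen_ord leNM i)).
  case: (ltnP i N) => [lti|gei]; last by rewrite pad_ge.
  by rewrite (pad_lt m (j := Ordinal lti)).
- exists k.+1 => N; apply: msize_le_coeff => m; rewrite mcoeff_mesym /mechar.
  by case: (mdeg m =P k) => [->|]; rewrite ?leqnn ?eqxx.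
Qed.

Definition hsym (k : nat) : symfun := SymFun (mhsym_is_symfun k).
Definition esym (k : nat) : symfun := SymFun (mesym_is_symfun k).

Lemma hsym0 : hsym 0 = 1.
Proof.
apply: symfunP => N; apply/mpolyP => m.
by rewrite [LHS]mcoeff_mhsym [RHS]mcoeff1 mdeg_eq0.
Qed.

Lemma esym0 : esym 0 = 1.
Proof. by apply: symfunP => N; exact: mesym0E. Qed.

End Generators.

Section Relation.
Variable (R : comNzRingType).

Lemma mcoeffMX_cond N (p : {mpoly R[N]}) (a m : 'X_{1..N}) :
  (p * 'X_[a])@_m = if (a <= m)%MM then p@_(m - a) else 0.
Proof.
case: ifPn => [le_am|nle_am].
  by rewrite -[in LHS](submK le_am) addmC mcoeffMX.
apply/eqP; rewrite mcoeff_eq0 (perm_mem (msuppMX _ _)).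
by apply: contra nle_am => /mapP[m' _ ->]; apply: lem_addr.
Qed.

Lemma sum_signed_subsets N (m : 'X_{1..N}) : (0 < mdeg m)%N ->
  \sum_(A : {set 'I_N}) (-1) ^+ #|A| * (mesym1 A <= m)%MM%:R = 0 :> R.
Proof.
move=> m_gt0; pose F (i : 'I_N) : R := - (0 < m i)%N%:R.
transitivity (\prod_(i < N) (F i + 1)).
  rewrite bigA_distr; apply: eq_bigr => A _.
  rewrite -big_mkcond /= prodrN; congr (_ * _).
  have -> : (mesym1 A <= m)%MM = [forall i in A, (0 < m i)%N].
    apply/mnm_lepP/forall_inP => H i.
      by move=> iA; have := H i; rewrite mnmE iA.
    by rewrite mnmE; case: (boolP (i \in A)) => // /H.
  have [/forall_inP A0|] := boolP [forall i in A, (0 < m i)%N]; first by rewrite big1 // => i /A0 ->.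
  rewrite negb_forall => /existsP[i]; rewrite negb_imply => /andP[iA /negPf i0].
  by rewrite (bigD1 i) //= i0 mul0r.
have [i mi|m0] := pickP (fun i : 'I_N => (0 < m i)%N).
  by rewrite (bigD1 i) //= /F mi addNr mul0r.
by move: m_gt0; rewrite mdegE big1 // => i _; apply/eqP; rewrite -leqn0 leqNgt m0.
Qed.

Lemma esym_hsym_rel (n : nat) : (0 < n)%N ->
  \sum_(i < n.+1) (-1) ^+ i *: (esym R i * hsym R (n - i)) = 0.
Proof.
move=> n_gt0; apply: symfunP => N.
pose c (f : symfun R) := components f N.
have cD : {morph c : x y / x + y} by [].
rewrite -/(c _) (big_morph c cD (erefl (c 0))) {cD}.
apply/mpolyP => m; rewrite [RHS]mcoeff0 raddf_sum /=.
have E (i : 'I_n.+1) : (c ((-1) ^+ i *: (esym R i * hsym R (n - i))))@_m =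
   \sum_(A : {set 'I_N} | #|A| == i) (mdeg m == n)%:R * ((-1) ^+ #|A| * (mesym1 A <= m)%MM%:R).
  rewrite (_ : c _ = (-1) ^+ i *: (mesym N R i * mhsym R N (n - i))) //.
  rewrite mcoeffZ mesymE mulr_suml raddf_sum mulr_sumr; apply: eq_bigr => A /eqP Ai.
  rewrite Ai /= [RHS]mulrCA; congr (_ * _).
  rewrite (mulrC 'X_[_]) mcoeffMX_cond.
  case: ifPn => [le_Am|_]; last by rewrite !mulr0.
  rewrite mulr1 mcoeff_mhsym; congr (_%:R); congr (nat_of_bool _).
  have := congr1 mdeg (submK le_Am); rewrite mdegD mdeg_mesym1 Ai => <-.
  by rewrite -(eqn_add2r i) subnK // -ltnS.
rewrite (eq_bigr _ (fun i _ => E i)) {E}.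
have [mn|mn] := eqVneq (mdeg m) n; last first.
  by rewrite big1 // => i _; rewrite big1 // => A _; rewrite mul0r.
have m_gt0 : (0 < mdeg m)%N by rewrite mn.
rewrite -[RHS](sum_signed_subsets m_gt0); under eq_bigr do rewrite big_mkcond.
rewrite exchange_big; apply: eq_bigr => A _ /=.
have [ltAn|leAn] := ltnP #|A| n.+1.
  rewrite (bigD1 (Ordinal ltAn)) //= eqxx mul1r big1 ?addr0 // => i ne_i.
  by case: eqP => // Ai; case/eqP: ne_i; apply/val_inj.
rewrite big1 => [|i _]; last first.
  by case: eqP => // Ai; have := ltn_ord i; rewrite -Ai ltnNge leAn.
have [le_Am|_] := boolP (mesym1 A <= m)%MM; last by rewrite mulr0.
have := congr1 mdeg (submK le_Am); rewrite mdegD mdeg_mesym1 mn => E.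
by move: leAn; rewrite -E ltnNge leq_addl.
Qed.
End Relation.

Section Omega.
Variable (R : comNzRingType).
Local Notation symfun := (symfun R).
Implicit Types (f g : symfun) (a : nat -> symfun).

Lemma rmorph_mmap M (A B : comNzRingType) (phi : {rmorphism A -> B})
    (u : R -> A) (v : 'I_M -> A) (t : {mpoly R[M]}) :
  phi (mmap u v t) = mmap (phi \o u) (phi \o v) t.
Proof.
rewrite /mmap rmorph_sum; apply: eq_bigr => m _; rewrite rmorphM; congr (_ * _).
by rewrite /mmap1 rmorph_prod; apply: eq_bigr => i _; rewrite rmorphXn.
Qed.

Lemma mmap_ext M (A : comNzRingType) (u u' : R -> A) (v v' : 'I_M -> A) (t : {mpoly R[M]}) :
  u =1 u' -> v =1 v' -> mmap u v t = mmap u' v' t.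
Proof.
move=> uu vv; apply: eq_bigr => m _; rewrite uu; congr (_ * _).
exact: mmap1_eq.
Qed.

(* The value t(a_1, ..., a_M); index 0 of the sequence a is not used. *)
Definition subst_seq M a (t : {mpoly R[M]}) : symfun :=
  mmap (in_alg symfun) (fun i : 'I_M => a i.+1) t.

Lemma subst_seqD M a (t u : {mpoly R[M]}) :
  subst_seq a (t + u) = subst_seq a t + subst_seq a u.
Proof. exact: mmapD. Qed.

Lemma subst_seqM M a (t u : {mpoly R[M]}) :
  subst_seq a (t * u) = subst_seq a t * subst_seq a u.
Proof. exact: (rmorphM (mmap (in_alg symfun) _)). Qed.

Lemma subst_seq1 M a : subst_seq a (1 : {mpoly R[M]}) = 1.
Proof. exact: (rmorph1 (mmap (in_alg symfun) _)). Qed.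

Lemma subst_seqZ M a c (t : {mpoly R[M]}) :
  subst_seq a (c *: t) = c *: subst_seq a t.
Proof. by rewrite /subst_seq mmapZ -[RHS]mulr_algl. Qed.

Lemma subst_seqX M a (i : 'I_M) : subst_seq a ('X_i : {mpoly R[M]}) = a i.+1.
Proof. by rewrite /subst_seq mmapX mmap1U. Qed.

Lemma components_subst M a (t : {mpoly R[M]}) N :
  components (subst_seq a t) N = t \mPo [tuple components (a i.+1) N | i < M].
Proof.
pose c (f : symfun) := components f N.
have cB : zmod_morphism c by [].
have cM : monoid_morphism c by [].
pose cA := GRing.isZmodMorphism.Build _ _ c cB.
pose cMM := GRing.isMonoidMorphism.Build _ _ c cM.
pose phi : {rmorphism symfun -> {mpoly R[N]}} := HB.pack c cA cMM.
rewrite -[LHS]/(phi _) rmorph_mmap; apply: mmap_ext => [x|i] /=.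
  by rewrite /c /= -alg_mpolyC.
by rewrite tnth_mktuple.
Qed.

Lemma subst_widen M M' a (t : {mpoly R[M]}) : (M <= M')%N ->
  subst_seq a (restr M' t) = subst_seq a t.
Proof.
move=> leM; rewrite /restr /comp_mpoly /subst_seq (rmorph_mmap (mmap (in_alg symfun) _)).
apply: mmap_ext => [x|i] /=; first by rewrite mmapC.
rewrite tnth_mktuple insubT /=; first exact: leq_trans leM.
by move=> lti; rewrite mmapX mmap1U.
Qed.

Lemma subst_esym_inj M : injective (@subst_seq M (esym R)).
Proof.
move=> t u /(congr1 (fun f => components f M)); rewrite !components_subst.
exact: msym_fundamental_un.
Qed.

Lemma components_restr f N M : (N <= M)%N ->
  restr N (components f M) = components f N.
Proof. by case: f => f /= /asboolP[_ fr _]; apply: fr. Qed.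

Lemma restrX_widen M M' (m : 'X_{1..M}) : (M <= M')%N ->
  restr M' 'X_[R, m] = 'X_[pad M' m].
Proof.
move=> leM; rewrite /restr comp_mpolyX [RHS]mpolyXE_id.
rewrite [RHS](bigID (fun i : 'I_M' => (i < M)%N)) /= (big_ord_narrow leM).
rewrite [X in _ = _ * X]big1 ?mulr1 => [|i]; last first.
  by rewrite -leqNgt => /pad_ge ->; rewrite expr0.
apply: eq_bigr => i _; rewrite (pad_lt m (j := i)) // tnth_mktuple.
rewrite insubT /=; first exact: leq_trans leM.
by move=> lti; congr ('X_ _ ^+ _); apply/val_inj.
Qed.

Lemma restr_restr_widen d N (t : {mpoly R[N]}) : (d <= N)%N ->
  (forall m, m \in msupp t -> forall i : 'I_N, (d <= i)%N -> m i = 0%N) ->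
  restr N (restr d t) = t.
Proof.
move=> ledN t0; rewrite [RHS]mpolyE {1}(mpolyE t) (restr_sum d) (restr_sum N).
rewrite [LHS]big_seq [RHS]big_seq. apply: eq_bigr => m /t0 m0.
by rewrite !restrZ restrX_in // restrX_widen // padK.
Qed.

Lemma mweight_supp d N (t : {mpoly R[N]}) : (mweight t <= d)%N ->
  forall m, m \in msupp t -> forall i : 'I_N, (d <= i)%N -> m i = 0%N.
Proof.
move=> td m mt i ledi; apply/eqP; rewrite -leqn0 leqNgt; apply/negP => mi.
have := leq_trans (mmeasure_mnm_lt mnmwgt mt) td.
rewrite /= /mnmwgt (bigD1 i) //= => /(leq_ltn_trans (leq_addr _ _)).
by rewrite ltnNge (leq_trans ledi) // (leq_trans (leqnSn i)) // leq_pmull.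
Qed.

Lemma subst_esym_surj f : exists M (t : {mpoly R[M]}), f = subst_seq (esym R) t.
Proof.
have fs N : components f N \is symmetric by case: f => f /= /asboolP[].
have [d fd] : exists d, forall N, (msize (components f N) <= d)%N.
  by case: f {fs} => f /= /asboolP[].
have [t [tE _]] := sym_fundamental (fs d).
have tE' : components (subst_seq (esym R) t) d = components f d.
  by rewrite components_subst -tE.
exists d, t; apply: symfunP => N.
have [leNd|/ltnW ledN] := leqP N d.
  by rewrite -(components_restr _ leNd) -tE' components_restr.
have [t1 [t1E t1w]] := sym_fundamental (fs N).
have t1E' : components (subst_seq (esym R) t1) N = components f N.
  by rewrite components_subst -t1E.
have := restr_restr_widen ledN (mweight_supp (leq_trans t1w (fd N))).
move=> t1K; rewrite -{}t1K subst_widen // in t1E'.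
rewrite -t1E'; congr (components (subst_seq _ _) N).
suff -> : restr d t1 = t by [].
apply: (@msym_fundamental_un _ R); rewrite tE -(components_restr f ledN) -t1E'.
by rewrite components_restr // components_subst.
Qed.

End Omega.

Section OmegaExists.
Variable (R : comNzRingType).
Local Notation symfun := (symfun R).
Local Notation e := (esym R).
Local Notation h := (hsym R).
Implicit Types (f g : symfun) (x y : nat -> symfun).

(* The relation between (e_j) and (h_j), which is symmetric in both. *)
Definition dual_seqs x y := [/\ x 0%N = 1, y 0%N = 1 & forall n, (0 < n)%N ->
  \sum_(i < n.+1) (-1) ^+ i *: (x i * y (n - i)%N) = 0].

Lemma dual_seqs_sym x y : dual_seqs x y -> dual_seqs y x.
Proof.
case=> x0 y0 xy; split=> // n n_gt0.
transitivity ((-1) ^+ n *: \sum_(i < n.+1) (-1) ^+ i *: (x i * y (n - i)%N)).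
  rewrite (reindex_inj rev_ord_inj) /= scaler_sumr.
  apply: eq_bigr => i _; rewrite subSS.
  have lein : (i <= n)%N by rewrite -ltnS.
  rewrite subKn // mulrC scalerA; congr (_ *: _).
  by rewrite -exprD -signr_odd -[RHS]signr_odd oddB // oddD.
by rewrite xy // scaler0.
Qed.

Lemma dual_seqs_swap x y (w : {lrmorphism symfun -> symfun}) :
  dual_seqs x y -> (forall j, w (x j) = y j) -> forall j, w (y j) = x j.
Proof.
move=> xyd wx j; have [_ _ yx] := dual_seqs_sym xyd; case: xyd => x0 y0 xy.
have wZM c f g : w (c *: (f * g)) = c *: (w f * w g) by rewrite linearZ /= rmorphM.
elim/ltn_ind: j => -[|n] ih; first by rewrite y0 rmorph1 x0.
have := congr1 w (xy n.+1 isT); rewrite rmorph0 raddf_sum /=.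
rewrite big_ord_recl /= wZM wx y0 subn0 mul1r expr0 scale1r => E.
have := yx n.+1 isT; rewrite -[RHS]E big_ord_recl y0 mul1r subn0 expr0 scale1r.
rewrite (eq_bigr (fun i : 'I_n.+1 =>
  w ((-1) ^+ lift ord0 i *: (x (lift ord0 i) * y (n.+1 - lift ord0 i)%N)))).
  by move/addIr.
move=> i _; rewrite wZM wx ih //.
by rewrite lift0 subSS ltnS leq_subr.
Qed.

Lemma esym_hsym_dual : dual_seqs e h.
Proof. by split; [apply: esym0 | apply: hsym0 | apply: esym_hsym_rel]. Qed.

Lemma subst_esym_compat M M' x (t : {mpoly R[M]}) (t' : {mpoly R[M']}) :
  subst_seq e t = subst_seq e t' -> subst_seq x t = subst_seq x t'.
Proof.
rewrite -(subst_widen e t (leq_maxl M M')) -(subst_widen e t' (leq_maxr M M')).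
move/subst_esym_inj => E.
by rewrite -(subst_widen x t (leq_maxl M M')) E subst_widen // leq_maxr.
Qed.

Lemma swap_fun_exists f :
  exists g, forall M (t : {mpoly R[M]}), f = subst_seq e t -> g = subst_seq h t.
Proof.
have [M [t ->]] := subst_esym_surj f.
by exists (subst_seq h t) => M' t'; apply: subst_esym_compat.
Qed.

(* Maps t(e_1, e_2, ...) to t(h_1, h_2, ...); the e_j are algebraically
   independent generators ([subst_esym_inj], [subst_esym_surj]). *)
Definition swap_fun f : symfun := sval (cid (swap_fun_exists f)).

Lemma swap_funE M (t : {mpoly R[M]}) : swap_fun (subst_seq e t) = subst_seq h t.
Proof. by rewrite /swap_fun; case: cid => g /=; apply. Qed.

Lemma subst_esym_surj2 f g : exists M (t u : {mpoly R[M]}),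
  f = subst_seq e t /\ g = subst_seq e u.
Proof.
have [M [t ->]] := subst_esym_surj f; have [M' [u ->]] := subst_esym_surj g.
exists (maxn M M'), (restr _ t), (restr _ u).
by rewrite !subst_widen ?leq_maxl ?leq_maxr.
Qed.

Fact swap_fun_is_linear : linear swap_fun.
Proof.
move=> c f g; have [M [t [u [-> ->]]]] := subst_esym_surj2 f g.
by rewrite -subst_seqZ -subst_seqD !swap_funE subst_seqD subst_seqZ.
Qed.

Fact swap_fun_is_monoid_morphism : monoid_morphism swap_fun.
Proof.
split=> [|f g]; first by rewrite -(subst_seq1 0 e) swap_funE !subst_seq1.
have [M [t [u [-> ->]]]] := subst_esym_surj2 f g.
by rewrite -subst_seqM !swap_funE subst_seqM.
Qed.

HB.instance Definition _ :=
  GRing.isLinear.Build R symfun symfun _ swap_fun swap_fun_is_linear.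
HB.instance Definition _ :=
  GRing.isMonoidMorphism.Build symfun symfun swap_fun swap_fun_is_monoid_morphism.

Lemma swap_fun_esym j : swap_fun (e j) = h j.
Proof.
case: j => [|j]; first by rewrite esym0 hsym0 rmorph1.
rewrite -[e j.+1](subst_seqX (M := j.+1) e (@ord_max j)) swap_funE.
by rewrite subst_seqX.
Qed.

Lemma eq_lrmorphism_esym (w w' : {lrmorphism symfun -> symfun}) :
  (forall j, w (e j) = w' (e j)) -> w =1 w'.
Proof.
move=> ww f; have [M [t ->]] := subst_esym_surj f.
rewrite /subst_seq !rmorph_mmap; apply: mmap_ext => [c|i] /=; last exact: ww.
by rewrite !rmorph_alg.
Qed.

Lemma omega_exists : exists w : {lrmorphism symfun -> symfun},
  (forall j, w (h j) = e j) /\ involutive w.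
Proof.
have he := dual_seqs_swap esym_hsym_dual swap_fun_esym.
exists swap_fun; split=> // f.
apply: (eq_lrmorphism_esym (w := swap_fun \o swap_fun) (w' := idfun)) => j /=.
by rewrite swap_fun_esym he.
Qed.

(* The R-linear ring involution with omega h_j = e_j (unique by [omega_uniq]). *)
Definition omega : {lrmorphism symfun -> symfun} := sval (cid omega_exists).

Lemma omega_hsym j : omega (h j) = e j.
Proof. by rewrite /omega; case: cid => w []. Qed.

Lemma omegaK : involutive omega.
Proof. by rewrite /omega; case: cid => w []. Qed.

Lemma omega_uniq (w : {lrmorphism symfun -> symfun}) :
  (forall j, w (h j) = e j) -> w =1 omega.
Proof.
move=> we; apply: eq_lrmorphism_esym => j.
have hed := dual_seqs_sym esym_hsym_dual.
by rewrite (dual_seqs_swap hed we) (dual_seqs_swap hed omega_hsym).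
Qed.

End OmegaExists.

(* The coefficient ring is Z[q], with q = 'X. *)

Notation Zq := {poly int}.
Notation Lambda := (symfun Zq).

Definition qint (n : nat) : Zq := \sum_(i < n) 'X^i.

(* [rho_list n] is [rho_n; ...; rho_1]; see [rho_rec] for the defining
   recursion. The value [rho 0 = 0] is junk. *)
Fixpoint rho_list (n : nat) : seq Lambda :=
  if n is n'.+1 then
    let r := rho_list n' in
    (qint n *: hsym _ n - \sum_(i < n') hsym _ i.+1 * r`_i) :: r
  else [::].

Definition rho (n : nat) : Lambda := head 0 (rho_list n).

Lemma nth_rho_list n i : (i < n)%N -> (rho_list n)`_i = rho (n - i).
Proof.
elim: n i => // n ih [|i] // lt_in.
by rewrite subSS -ih.
Qed.

Lemma rho_rec n : (0 < n)%N ->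
  qint n *: hsym _ n = \sum_(i < n) hsym _ i * rho (n - i).
Proof.
case: n => // n _; rewrite big_ord_recl hsym0 mul1r subn0 {1}/rho /=.
rewrite [X in _ = _ + X](eq_bigr (fun i : 'I_n => hsym _ i.+1 * (rho_list n)`_i)).
  by rewrite subrK.
by move=> i _; rewrite nth_rho_list // lift0 subSS.
Qed.

Section Hessenberg.
Variable n : nat.
Implicit Types (m : 'I_n -> 'I_n) (s : 'S_n).

(* The set {1, ..., n} is represented by 'I_n = {0, ..., n - 1}. *)

Definition is_hessenberg m :=
  (forall i : 'I_n, (i <= m i)%N) /\ {homo m : i j / (i <= j)%N}.

Definition in_hess m s := [forall i, (s i <= m i)%N].

(* The cycle decomposition, as words: each cycle is read x, s x, s (s x), ...
   from its smallest element x, and [enum 'I_n] is increasing. *)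
Definition cycles s : seq (seq 'I_n) :=
  [seq fingraph.orbit s x |
     x : 'I_n <- enum 'I_n & all (fun y : 'I_n => (x <= y)%N) (fingraph.orbit s x)].

(* The one-line notation of sigma^c; (sigma^c)^{-1}(i) is [index i (cycle_word s)]. *)
Definition cycle_word s : seq 'I_n := flatten (cycles s).

Definition wt m s : nat :=
  #|[set p : 'I_n * 'I_n | (p.1 < p.2 <= m p.1)%N
      && (index p.2 (cycle_word s) < index p.1 (cycle_word s))%N]|.

Definition first_length s : nat := size (head [::] (cycles s)).

(* g_k(m; x, q); only meaningful for k < n. *)
Definition gsym m (k : nat) : Lambda :=
  \sum_(s : 'S_n | in_hess m s && (n - k <= first_length s)%N)
    let d := (first_length s - (n - k))%N in
    ((-1) ^+ d * 'X^(wt m s)) *: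
      (hsym _ d * omega _ (\prod_(t <- behead (cycles s)) rho (size t))).

Fact path_hess_subproof (i : 'I_n) : (minn i.+1 n.-1 < n)%N.
Proof. by rewrite gtn_min orbC prednK ?leqnn // (leq_ltn_trans _ (ltn_ord i)). Qed.

Definition path_hess (i : 'I_n) : 'I_n := Ordinal (path_hess_subproof i).

Lemma path_hess_is_hessenberg : is_hessenberg path_hess.
Proof.
split=> [i|i j le_ij] /=; last first.
  by rewrite leq_min !geq_min ltnS le_ij leqnn orbT.
by rewrite leq_min leqnSn -ltnS prednK ?(leq_ltn_trans _ (ltn_ord i)).
Qed.

End Hessenberg.

(* Partitions are weakly decreasing lists of positive integers. *)
Definition is_part (l : seq nat) : bool := sorted geq l && (0%N \notin l).

Definition esym_part (l : seq nat) : Lambda := \prod_(i <- l) esym _ i.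

(* The e_l are linearly independent, so c is the expansion of f on S. *)
Definition e_positive (f : Lambda) : Prop :=
  exists (S : seq (seq nat)) (c : seq nat -> Zq),
    [/\ uniq S, all is_part S, forall l i, l \in S -> 0 <= (c l)`_i
      & f = \sum_(l <- S) c l *: esym_part l].

(* Main.v *)
(* A permutation s with s i <= i + 1 is a product of cycles (a, a + 1, ..., b)
   on consecutive intervals, so for a path sigma^c is the identity, the weight
   vanishes, and g_k is a sum over compositions. With H(z) = sum_n h_n z^n and
   E(z) = sum_n e_n z^n, the defining recursion of rho sums to
     sum_k g_k z^k = (1 - q) / (E(q z) - q E(z))
                   = 1 / (1 - sum_(n >= 2) q [n - 1]_q e_n z^n),
   whence g_0 = 1 and g_k = sum_(i >= 2) q [i - 1]_q e_i g_(k - i). *)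

Require Import Defs.
From HB Require Import structures.
From mathcomp Require Import all_boot all_order all_algebra all_fingroup.
From mathcomp Require Import boolp zify.

Set Implicit Arguments.
Unset Strict Implicit.
Unset Printing Implicit Defensive.

Import GRing.Theory Num.Theory.

Local Open Scope ring_scope.

(** * Formal power series as coefficient sequences, with convolution as product *)

Section Convolution.
Variable R : comNzRingType.
Implicit Types u v w : nat -> R.

Definition conv u v (n : nat) : R := \sum_(i < n.+1) u i * v (n - i)%N.

Definition conv1 (n : nat) : R := (n == 0%N)%:R.

(** Truncating at any degree above [n] keeps coefficient [n], so commutativity and associativity
    transfer from polynomials. *)
Lemma conv_coef u v n N : (n < N)%N ->
  conv u v n = ((\poly_(i < N) u i) * (\poly_(i < N) v i))`_n.
Proof.
move=> ltnN; rewrite coefM; apply: eq_bigr => i _.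
by rewrite !coef_poly !(leq_ltn_trans _ ltnN) ?leq_subr // -ltnS.
Qed.

Lemma convC u v : conv u v = conv v u.
Proof. by apply/funext => n; rewrite !(conv_coef _ _ (ltnSn n)) mulrC. Qed.

Lemma convA u v w : conv u (conv v w) = conv (conv u v) w.
Proof.
have coefl N a b c n : (n < N)%N -> conv (conv a b) c n =
    ((\poly_(i < N) a i) * (\poly_(i < N) b i) * (\poly_(i < N) c i))`_n.
  move=> ltnN; rewrite coefM; apply: eq_bigr => i _.
  by rewrite (@conv_coef _ _ _ N) ?coef_poly ?(leq_ltn_trans _ ltnN) ?leq_subr // -ltnS.
apply/funext => n; rewrite (convC u) !(coefl _ _ _ _ _ (ltnSn n)).
by congr (_`__); rewrite mulrC mulrA.
Qed.

Lemma conv1l u : conv conv1 u = u.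
Proof.
apply/funext => n; rewrite /conv big_ord_recl subn0 mul1r big1 ?addr0 // => i _.
by rewrite mul0r.
Qed.

Lemma convDr u v w : conv u (v \+ w) = conv u v \+ conv u w.
Proof.
by apply/funext => n; rewrite /conv /= -big_split; apply: eq_bigr => i _; rewrite mulrDr.
Qed.

End Convolution.

(** * Compositions of an integer *)

Section Compositions.

(** The fuel [f] makes the recursion structural; [n <= f] suffices because every part is at least
    1. *)
Fixpoint fuel_compositions (f n : nat) : seq (seq nat) :=
  if n is 0 then [:: [::]] else
  if f is f'.+1 then [seq a :: c | a <- iota 1 n, c <- fuel_compositions f' (n - a)]
  else [::].

Definition compositions (n : nat) := fuel_compositions n n.

Lemma mem_fuel_compositions f n c : (n <= f)%N ->
  (c \in fuel_compositions f n) = (sumn c == n) && (0%N \notin c).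
Proof.
elim: f n c => [|f IHf] [|n] c // le_nf.
- by case: c => [|[|a] c]; rewrite //= !inE /= ?andbF.
- by case: c => [|[|a] c]; rewrite //= !inE /= ?andbF.
apply/allpairsPdep/idP => [[a [d [a_in + ->]]]|].
  have: a \in iota 1 n.+1 by [].
  rewrite mem_iota => /andP[a_gt0 lean].
  rewrite IHf; last by lia.
  by move=> /andP[/eqP sumd d0]; rewrite /= inE negb_or d0 sumd; lia.
case: c => [|a c]; rewrite //= inE negb_or => /and3P[/eqP sumc a0 c0].
have a_in : a \in iota 1 n.+1 by rewrite mem_iota; lia.
by exists a, c; split=> //; rewrite IHf ?c0; lia.
Qed.

Lemma fuel_compositions_uniq f n : uniq (fuel_compositions f n).
Proof.
elim: f n => [|f IHf] [|n] //.
apply: allpairs_uniq_dep; first exact: iota_uniq.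
  by move=> a _; apply: IHf.
by move=> [a c] [b d] _ _ [-> ->].
Qed.

Lemma mem_compositions n c :
  (c \in compositions n) = (sumn c == n) && (0%N \notin c).
Proof. exact: mem_fuel_compositions. Qed.

Lemma sum_compositions_rec (V : nmodType) n (P : pred (seq nat)) (F : seq nat -> V) :
  (0 < n)%N -> \sum_(c <- compositions n | P c) F c =
  \sum_(1 <= a < n.+1) \sum_(c <- compositions (n - a) | P (a :: c)) F (a :: c).
Proof.
case: n => // n _; rewrite /compositions big_mkcond.
have -> : fuel_compositions n.+1 n.+1 =
  [seq a :: c | a <- iota 1 n.+1, c <- fuel_compositions n (n.+1 - a)] by [].
rewrite big_allpairs_dep /index_iota subSS subn0.
rewrite big_seq [RHS]big_seq; apply: eq_bigr => a; rewrite mem_iota => a_range.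
rewrite -big_mkcond; apply: perm_big.
apply: uniq_perm; rewrite ?fuel_compositions_uniq // => c.
by rewrite !mem_fuel_compositions; lia.
Qed.

End Compositions.

(** * Permutations that rotate consecutive intervals *)

Section BlockRotation.

(* The permutation of {0, ..., sumn c - 1} whose cycles are the consecutive
   intervals of lengths c_1, c_2, ... *)
Fixpoint block_next (c : seq nat) (i : nat) : nat :=
  if c is a :: c' then
    if (i < a)%N then if i.+1 == a then 0%N else i.+1
    else (a + block_next c' (i - a))%N
  else i.

Lemma block_next_lt c i : (i < sumn c)%N -> (block_next c i < sumn c)%N.
Proof.
elim: c i => //= a c IHc i lti; case: (ltnP i a) => [?|?]; first by case: (i.+1 =P a); lia.
by rewrite ltn_add2l IHc //; lia.
Qed.

Lemma block_next_leS c i : (block_next c i <= i.+1)%N.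
Proof.
elim: c i => [|a c IHc] i /=; first exact: leqnSn.
by have := IHc (i - a)%N; case: (ltnP i a) => [?|?]; [case: (i.+1 =P a)|]; lia.
Qed.

Lemma block_next_inj c : {in gtn (sumn c) &, injective (block_next c)}.
Proof.
elim: c => [|a c IHc] i j; rewrite !inE //= => lti ltj.
case: (ltnP i a) => [?|?]; case: (ltnP j a) => [?|?];
  try by case: (i.+1 =P a); case: (j.+1 =P a); lia.
move/addnI => E; suff: (i - a = j - a)%N by lia.
by apply: IHc => //; rewrite inE; lia.
Qed.

(** The first part is recovered as one more than the index sent to 0: if [a < b], then at [a.-1] one
    map returns to 0 and the other moves on to [a]. The tails are compared by induction. *)
Lemma block_next_comp_inj c d : 0%N \notin c -> 0%N \notin d ->
  sumn c = sumn d -> {in gtn (sumn c), block_next c =1 block_next d} -> c = d.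
Proof.
elim: c d => [|a c IHc] [|b d]; rewrite //= ?inE ?negb_or; try by move=> *; lia.
move=> /andP[a0 c0] /andP[b0 d0] sumE nextE.
have eq_ab: a = b.
  have Ea := nextE a.-1; have Eb := nextE b.-1.
  rewrite !inE in Ea Eb.
  case: (ltngtP a b) => // lt_ab.
    have: (a.-1 < a + sumn c)%N by lia.
    by move/Ea; do ![case: ltnP => ?|case: eqP => ?]; lia.
  have: (b.-1 < a + sumn c)%N by lia.
  by move/Eb; do ![case: ltnP => ?|case: eqP => ?]; lia.
subst b; congr (_ :: _); apply: IHc => // [|i]; first by lia.
rewrite !inE => lti; have := nextE (a + i)%N; rewrite !inE ltn_add2l => /(_ lti).
by rewrite ltnNge leq_addr /= addKn => /addnI.
Qed.

(** Each block is an interval read in increasing order, so [next] is the successor inside it and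
    wraps from its last entry to its first. *)
Lemma fcycle_blocks_next (f : nat -> nat) (L : seq (seq nat)) b :
  all (fcycle f) L -> [::] \notin L -> flatten L = iota b (sumn (shape L)) ->
  forall i, (i < sumn (shape L))%N -> f (b + i)%N = (b + block_next (shape L) i)%N.
Proof.
elim: L b => //= B L IHL b /andP[cycB cycL]; rewrite inE negb_or => /andP[B0 L0].
rewrite iotaD => /eqP; rewrite eqseq_cat ?size_iota // => /andP[/eqP BE /eqP LE] i lti.
case: (ltnP i (size B)) => [ltiB|leBi]; last first.
  by have := IHL _ cycL L0 LE (i - size B)%N; rewrite addnA -(addnA b) subnKC // => -> //; lia.
have szB : (0 < size B)%N by case: (B) B0.
have iB : (b + i)%N \in B by rewrite BE mem_iota; lia.
have uB : uniq B by rewrite BE iota_uniq.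
have /eqP -> := next_cycle cycB iB.
have idx : index (b + i)%N B = i.
  by rewrite -[X in index X](_ : nth 0%N B i = _) ?index_uniq // BE nth_iota.
case B1: B szB BE ltiB idx iB => [//|x B'] _ BE ltiB idx iB.
rewrite next_nth iB idx.
have xb : x = b by case: BE.
have B'E : B' = iota b.+1 (size B') by case: BE.
case: (i.+1 =P size (x :: B')) => /= [[E]|ne].
  by rewrite nth_default ?E // xb addn0.
have ltiB' : (i < size B')%N by move: ltiB => /=; lia.
by rewrite B'E nth_iota // addnS.
Qed.

End BlockRotation.

(** * Cycle structure of permutations with [s i <= i.+1] *)

Section UnitStepPermutations.
Variables (N : nat) (s : 'S_N).
Hypothesis s_le : forall i, (s i <= i.+1)%N.

Local Notation orb := (fingraph.orbit s).
Local Notation is_min x := (all (fun y : 'I_N => (x <= y)%N) (orb x)).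

Lemma orbit_min_iota (x : 'I_N) : is_min x ->
  map val (orb x) = iota x (size (orb x)).
Proof.
move=> /allP minx.
suff E i : (i < size (orb x))%N -> iter i s x = (x + i)%N :> nat.
  apply: (@eq_from_nth _ 0%N) => [|i]; rewrite ?size_map ?size_iota // => lti.
  rewrite (nth_map x) // nth_iota // -E //.
  by rewrite nth_traject // -(size_orbit s x).
elim/ltn_ind: i => -[_ _|i IHi lti]; first by rewrite addn0.
have iter_orb j : iter j s x \in orb x by rewrite -fconnect_orbit fconnect_iter.
have := s_le (iter i s x); rewrite IHi ?(ltnW lti) // leq_eqVlt => /orP[/eqP|]; first by rewrite addnS.
have := minx _ (iter_orb i.+1); rewrite /= => lex; rewrite ltnS => leS.
(* A value at most [x + i] is already the iterate of index [j <= i], which contradicts that the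
   orbit has no repetition. *)
pose j := (iter i.+1 s x - x)%N.
have ltji : (j < i.+1)%N by rewrite /j /=; lia.
have E : iter j s x = iter i.+1 s x.
  by apply: val_inj; rewrite /= IHi // ?(ltn_trans ltji) // /j /=; lia.
have := orbit_uniq s x; move/(uniqP x)/(_ j i.+1); rewrite !inE.
rewrite (ltn_trans ltji lti) lti !nth_traject -?(size_orbit s x) ?(ltn_trans ltji lti) //.
by move=> /(_ isT isT E) ji; rewrite ji ltnn in ltji.
Qed.

Lemma pairwise_flatten (T : Type) (r : rel T) (L : seq (seq T)) :
  pairwise r (flatten L) = all (pairwise r) L && pairwise (allrel r) L.
Proof.
elim: L => //= B L IHL; rewrite pairwise_cat IHL.
have -> : allrel r B (flatten L) = all (allrel r B) L.
  by elim: (L) => [|C L' IH]; rewrite ?allrel0r // allrel_catr IH.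
by do 2![case: (pairwise r _); rewrite ?andbF //]; case: (all _ _); rewrite ?andbF ?andbT.
Qed.

(** Both words are strictly increasing with the same letters: the cycles are intervals, listed by
    increasing minimum. *)
Lemma flatten_cycles_enum : cycle_word s = enum 'I_N.
Proof.
pose ltI (i j : 'I_N) := (i < j)%N.
have ltI_tr : transitive ltI by move=> y x z; apply: ltn_trans.
have enum_sorted : sorted ltI (enum 'I_N).
  by have := iota_ltn_sorted 0 N; rewrite -val_enum_ord sorted_map.
apply: (irr_sorted_eq ltI_tr) => //; first by move=> x; apply: ltnn.
  rewrite sorted_pairwise // pairwise_flatten; apply/andP; split.
    rewrite all_map; apply/allP => x; rewrite mem_filter => /andP[minx _] /=.
    have := iota_ltn_sorted x (size (orb x)); rewrite -orbit_min_iota //.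
    by rewrite sorted_map sorted_pairwise //.
  rewrite pairwise_map.
  apply: (@sub_in_pairwise _ (fun x : 'I_N => is_min x) ltI); last first.
  - by rewrite -sorted_pairwise // sorted_filter.
  - by apply/allP => x; rewrite mem_filter => /andP[].
  move=> x x' minx minx' ltxx'; apply/allrelP => y y' yx y'x'.
  have : val y \in map val (orb x) by apply: map_f.
  (* Otherwise [x] would lie in the orbit of [x'], below its minimum. Hence the interval starting at
     [x] ends before [x']. *)
  have : val x' \notin map val (orb x).
    rewrite mem_map; last exact: val_inj.
    apply/negP; rewrite -fconnect_orbit fconnect_sym; last exact: perm_inj.
    by rewrite fconnect_orbit => /(allP minx'); rewrite leqNgt -/(ltI x x') ltxx'.
  have := allP minx' _ y'x'; rewrite orbit_min_iota // !mem_iota /= /ltI.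
  by move: ltxx'; rewrite /ltI; lia.
move=> y; rewrite mem_enum; apply/flattenP.
have [x yx minx] : exists2 x : 'I_N, x \in orb y & forall z, z \in orb y -> (x <= z)%N.
  have y_in : y \in orb y by rewrite in_orbit.
  by case: (@arg_minnP _ y (mem (orb y)) val y_in) => x; exists x.
exists (orb x).
  apply: map_f; rewrite mem_filter mem_enum andbT; apply/allP => z zx; apply: minx.
  by rewrite -!fconnect_orbit in yx zx *; apply: connect_trans yx zx.
by rewrite -fconnect_orbit fconnect_sym ?fconnect_orbit //; apply: perm_inj.
Qed.


Lemma shape_cycles_composition : shape (cycles s) \in compositions N.
Proof.
rewrite mem_compositions -size_flatten -[flatten _]/(cycle_word s) flatten_cycles_enum.
rewrite size_enum_ord eqxx; apply/mapP => -[B] /mapP[x _ ->].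
by rewrite size_orbit => /esym/eqP; rewrite eqn0Ngt fingraph.order_gt0.
Qed.

Lemma unit_step_block_next (i : 'I_N) : s i = block_next (shape (cycles s)) i :> nat.
Proof.
(* [s] transported to [nat]; the default 0 is only taken outside the range of ['I_N]. *)
pose f j := oapp (fun i : 'I_N => val (s i)) 0%N (insub j).
have fE (j : 'I_N) : f j = s j by rewrite /f valK.
have shE : shape (map (map val) (cycles s)) = shape (cycles s).
  by rewrite /shape -map_comp; apply: eq_map => B /=; rewrite size_map.
have sumE : sumn (shape (cycles s)) = N.
  by have := shape_cycles_composition; rewrite mem_compositions => /andP[/eqP].
have := @fcycle_blocks_next f (map (map val) (cycles s)) 0 _ _ _ i.
rewrite shE sumE ltn_ord !add0n fE; apply => //.
- rewrite all_map; apply/allP => B /mapP[x _ ->] /=.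
  rewrite (eq_cycle (e' := fun i j : nat => f i == j)) //.
  rewrite cycle_map (eq_cycle (e' := frel s)); first exact/cycle_orbit/perm_inj.
  by move=> j l /=; rewrite fE.
- apply/mapP => -[B] /mapP[x _ ->] /(congr1 size); rewrite size_map size_orbit /=.
  by move/esym/eqP; rewrite eqn0Ngt fingraph.order_gt0.
- by rewrite -map_flatten -[flatten _]/(cycle_word s) flatten_cycles_enum val_enum_ord.
Qed.

(** The cycle word is the identity, so it has no inversions to count. *)
Lemma wt_unit_step (m : 'I_N -> 'I_N) : wt m s = 0%N.
Proof.
apply/eqP; rewrite cards_eq0; apply/eqP/setP => p; rewrite !inE.
by rewrite flatten_cycles_enum !index_enum_ord; lia.
Qed.

End UnitStepPermutations.

(** * Path-admissible permutations correspond to compositions *)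

Section PathPermutations.
Variable N : nat.

Lemma in_hess_pathP (s : 'S_N) :
  reflect (forall i, (s i <= i.+1)%N) (in_hess (@path_hess N) s).
Proof.
apply: (iffP forallP) => H i; first by apply: leq_trans (H i) _; apply: geq_minl.
by have := ltn_ord (s i); rewrite leq_min H /=; lia.
Qed.

Lemma block_perm_exists c : sumn c = N ->
  exists s : 'S_N, forall i, s i = block_next c i :> nat.
Proof.
move=> sumc; pose g (i : 'I_N) := insubd i (block_next c i).
have gE i : g i = block_next c i :> nat.
  by rewrite val_insubd -[X in (_ < X)%N]sumc block_next_lt // sumc.
have g_inj : injective g.
  move=> i j /(congr1 val); rewrite /= !gE => /block_next_inj E.
  by apply/val_inj/E; rewrite inE sumc.
by exists (perm g_inj) => i; rewrite permE.
Qed.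

(** The cycle lengths determine [s] by [unit_step_block_next], and every composition is reached by
    its block rotation. *)
Lemma perm_shape_cycles :
  perm_eq [seq shape (cycles s) | s : {perm 'I_N} <- index_enum _ & in_hess (@path_hess N) s]
    (compositions N).
Proof.
apply: uniq_perm; rewrite ?fuel_compositions_uniq //.
  rewrite map_inj_in_uniq ?filter_uniq ?index_enum_uniq // => s t.
  rewrite !mem_filter => /andP[/in_hess_pathP hs _] /andP[/in_hess_pathP ht _] st.
  by apply/permP => i; apply: val_inj; rewrite /= !unit_step_block_next // st.
move=> c; apply/mapP/idP => [[s]|].
  by rewrite mem_filter => /andP[/in_hess_pathP hs _] ->; apply: shape_cycles_composition.
rewrite mem_compositions => /andP[/eqP sumc c0].
have [s sE] := block_perm_exists sumc.
have hs i : (s i <= i.+1)%N by rewrite sE block_next_leS.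
exists s; first by rewrite mem_filter mem_index_enum andbT; apply/in_hess_pathP.
have := shape_cycles_composition hs; rewrite mem_compositions => /andP[/eqP sumS S0].
apply: block_next_comp_inj => //; first by rewrite sumS.
move=> i; rewrite inE sumc => lti.
by rewrite -(sE (Ordinal lti)) unit_step_block_next.
Qed.

Lemma sum_path_permutations (V : nmodType) (P : pred (seq nat)) (F : seq nat -> V) :
  \sum_(s : 'S_N | in_hess (@path_hess N) s && P (shape (cycles s))) F (shape (cycles s)) =
  \sum_(c <- compositions N | P c) F c.
Proof.
by rewrite -(perm_big _ perm_shape_cycles) big_map big_filter_cond.
Qed.

End PathPermutations.

(** * Closure properties of e-positivity *)

Section EPositivity.

Definition coef_nonneg (p : Zq) : Prop := forall i, 0 <= p`_i.

Lemma coef_nonnegD p q : coef_nonneg p -> coef_nonneg q -> coef_nonneg (p + q).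
Proof. by move=> p0 q0 i; rewrite coefD addr_ge0. Qed.

Lemma coef_nonnegM p q : coef_nonneg p -> coef_nonneg q -> coef_nonneg (p * q).
Proof. by move=> p0 q0 i; rewrite coefM sumr_ge0 // => j _; rewrite mulr_ge0. Qed.

Lemma coef_nonnegXn n : coef_nonneg 'X^n.
Proof. by move=> i; rewrite coefXn ler0n. Qed.

Lemma coef_nonneg_qint n : coef_nonneg (qint n).
Proof. by move=> i; rewrite coef_sum sumr_ge0 // => j _; apply: coef_nonnegXn. Qed.

Lemma e_positive0 : e_positive 0.
Proof. by exists [::], (fun=> 0); rewrite big_nil. Qed.

Lemma e_positiveD f g : e_positive f -> e_positive g -> e_positive (f + g).
Proof.
move=> [S [c [uS pS c0 ->]]] [T [d [uT pT d0 ->]]].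
(* Coefficients are unconstrained off their support, so both families are extended by zero before
   being added over the union. *)
pose ext (U : seq (seq nat)) (a : seq nat -> Zq) l := if l \in U then a l else 0.
have ext_ge0 U (a : seq nat -> Zq) : (forall l i, l \in U -> 0 <= (a l)`_i) -> forall l, coef_nonneg (ext U a l).
  by move=> a0 l i; rewrite /ext; case: ifP => [/a0|_] //; rewrite coef0.
have extE (U W : seq (seq nat)) a : uniq U -> {subset U <= W} ->
    \sum_(l <- U) a l *: esym_part l = \sum_(l <- undup W) ext U a l *: esym_part l.
  move=> uU UW; rewrite [RHS](bigID (mem U)) /= [X in _ + X]big1 ?addr0; last first.
    by move=> l /negPf lU; rewrite /ext lU scale0r.
  rewrite (perm_big [seq l <- undup W | l \in U]) /=; last first.
    apply: uniq_perm; rewrite ?filter_uniq ?undup_uniq // => l.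
    by rewrite mem_filter mem_undup andb_idr //; apply: UW.
  by rewrite big_filter; apply: eq_bigr => l lU; rewrite /ext lU.
exists (undup (S ++ T)), (fun l => ext S c l + ext T d l); split.
- exact: undup_uniq.
- by apply/allP => l; rewrite mem_undup mem_cat => /orP[/(allP pS)|/(allP pT)].
- by move=> l i _; apply: coef_nonnegD; apply: ext_ge0.
under [RHS]eq_bigr do rewrite scalerDl.
rewrite big_split; congr (_ + _); apply: extE => // l; rewrite mem_cat => ->;
  by rewrite ?orbT.
Qed.

Lemma e_positive_sum I (r : seq I) (P : pred I) F :
  (forall i, P i -> e_positive (F i)) -> e_positive (\sum_(i <- r | P i) F i).
Proof. exact: (big_ind e_positive e_positive0 e_positiveD). Qed.

(** The product ignores the order of the factors, so sorting [l] gives a partition. *)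
Lemma e_positive_monomial (a : Zq) l :
  0%N \notin l -> coef_nonneg a -> e_positive (a *: esym_part l).
Proof.
move=> l0 a0; exists [:: sort geq l], (fun=> a); split=> //.
- rewrite /= andbT /is_part mem_sort l0 andbT sort_sorted // => i j; apply: leq_total.
- rewrite big_seq1; congr (_ *: _); apply: perm_big.
  by rewrite perm_sym perm_sort.
Qed.

Lemma e_positive1 : e_positive 1.
Proof.
have -> : 1 = 1 *: esym_part [::] by rewrite /esym_part big_nil scale1r.
by apply: e_positive_monomial => // i; rewrite -(expr0 'X); apply: coef_nonnegXn.
Qed.

Lemma e_positive_scale_esym (a : Zq) j f :
  coef_nonneg a -> e_positive f -> e_positive (a *: (Defs.esym _ j.+1 * f)).
Proof.
move=> a0 [S [c [uS /allP pS c0 ->]]].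
rewrite mulr_sumr scaler_sumr big_seq; apply: e_positive_sum => l lS.
have -> : a *: (Defs.esym _ j.+1 * (c l *: esym_part l)) = (a * c l) *: esym_part (j.+1 :: l).
  by rewrite /esym_part big_cons -scalerAr scalerA.
apply: e_positive_monomial; first by have /andP[_] := pS _ lS.
by apply: coef_nonnegM => // i; apply: c0.
Qed.

End EPositivity.

(** * Generating function identities and the positive recursion *)

Section Recurrence.

Local Notation e := (Defs.esym Zq).
Local Notation h := (hsym Zq).
Local Notation omega := (omega Zq).

(** The coefficients of H(-z), the inverse of E(z). *)
Definition signed_hsym (n : nat) : Lambda := (-1) ^+ n *: h n.

Definition omega_rho (n : nat) : Lambda := omega (rho n).

(** The coefficients of 1 / (1 - R(z)), where R is the generating function of [omega_rho]. *)
Definition omega_rho_sum (n : nat) : Lambda :=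
  \sum_(c <- compositions n) \prod_(t <- c) omega_rho t.

Lemma omega_rho0 : omega_rho 0 = 0.
Proof. exact: raddf0. Qed.

Lemma conv_signed_hsym_esym : conv signed_hsym e = conv1 _.
Proof.
have [h0 e0 he] := dual_seqs_sym (esym_hsym_dual Zq).
apply/funext => -[|n]; rewrite /conv /conv1.
  by rewrite big_ord1 /signed_hsym expr0 scale1r h0 e0 mul1r.
by rewrite -[RHS](he n.+1) //; apply: eq_bigr => i _; rewrite -scalerAl.
Qed.

(** This is [omega] applied to [rho_rec]; the extra last term of the convolution vanishes because
    [rho 0 = 0]. *)
Lemma conv_esym_omega_rho : conv e omega_rho = fun n => qint n *: e n.
Proof.
apply/funext => -[|n]; rewrite /conv.
  by rewrite big_ord1 omega_rho0 mulr0 /qint big_ord0 scale0r.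
rewrite big_ord_recr /= subnn omega_rho0 mulr0 addr0.
have := congr1 omega (rho_rec (ltn0Sn n)).
rewrite linearZ /= omega_hsym raddf_sum => ->.
by apply: eq_bigr => i _ /=; rewrite rmorphM /= omega_hsym.
Qed.

Lemma omega_rho_sum_rec : omega_rho_sum = conv1 _ \+ conv omega_rho omega_rho_sum.
Proof.
apply/funext => -[|n]; rewrite /= /conv /conv1.
  by rewrite big_ord1 omega_rho0 mul0r addr0 /omega_rho_sum /compositions big_seq1 big_nil.
rewrite add0r big_ord_recl omega_rho0 mul0r add0r.
rewrite {1}/omega_rho_sum (sum_compositions_rec xpredT) //.
rewrite big_add1 big_mkord; apply: eq_bigr => i _; rewrite lift0 mulr_sumr.
by apply: eq_bigr => c _; rewrite big_cons.
Qed.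

(** The value of [g_k] for paths, in a form free of [N]; see [gsym_path]. *)
Definition path_sum : nat -> Lambda := conv signed_hsym omega_rho_sum.

(* With G, S, A, R the generating functions of path_sum, signed_hsym,
   omega_rho_sum, omega_rho: G = S A and A = 1 + R A give G = S + R G; multiply
   by E = 1 / S. *)
Lemma conv_esym_path_sum :
  conv e path_sum = conv1 _ \+ conv (fun n => qint n *: e n) path_sum.
Proof.
have G_rec : path_sum = signed_hsym \+ conv omega_rho path_sum.
  rewrite {1}/path_sum omega_rho_sum_rec convDr convC conv1l; congr (_ \+ _).
  by rewrite convA (convC _ omega_rho) -convA.
by rewrite {1}G_rec convDr (convC e) conv_signed_hsym_esym convA conv_esym_omega_rho.
Qed.

Lemma qintS n : qint n.+1 = 1 + 'X * qint n.
Proof.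
rewrite /qint big_ord_recl expr0 mulr_sumr; congr (_ + _).
by apply: eq_bigr => i _; rewrite lift0 exprS.
Qed.

(** Since [qint i.+1 - 1 = 'X * qint i], moving the terms of E(z) G(z) across leaves only
    non-negative coefficients. *)
Lemma path_sum_rec n :
  path_sum n.+1 = \sum_(i < n.+1) ('X * qint i) *: (e i.+1 * path_sum (n - i)).
Proof.
have := congr1 (fun u : nat -> Lambda => u n.+1) conv_esym_path_sum.
(* The terms of index 0 are split off: [e 0 = 1] isolates [path_sum n.+1] on the left, and
   [qint 0 = 0] removes it on the right. *)
rewrite /= /conv /conv1 add0r !(big_ord_recl n.+1) /= esym0 mul1r subn0.
rewrite [qint 0](big_ord0) scale0r mul0r add0r => /(canRL (addrK _)) ->.
rewrite -sumrB; apply: eq_bigr => i _; rewrite /bump add1n subSS qintS.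
by rewrite scalerDl scale1r mulrDl addrC addKr scalerAl.
Qed.

Lemma path_sum_e_positive n : e_positive (path_sum n).
Proof.
elim/ltn_ind: n => -[_|n IHn].
  have -> : path_sum 0 = 1.
    rewrite /path_sum /conv big_ord1 /signed_hsym expr0 scale1r hsym0 mul1r.
    by rewrite /omega_rho_sum big_seq1 big_nil.
  exact: e_positive1.
rewrite path_sum_rec; apply: e_positive_sum => i _; apply: e_positive_scale_esym.
  by apply: coef_nonnegM; [apply: (coef_nonnegXn 1) | apply: coef_nonneg_qint].
by apply: IHn; rewrite ltnS leq_subr.
Qed.

(** A first part [N - k + i] contributes the signed [h i] and leaves a composition of [k - i], so
    the sum is a convolution in which [N] cancels. *)
Lemma gsym_path (N k : nat) : (k < N)%N -> gsym (@path_hess N) k = path_sum k.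
Proof.
move=> ltkN; pose F c := let d := (head 0 c - (N - k))%N in
  signed_hsym d * \prod_(t <- behead c) omega_rho t.
transitivity (\sum_(c <- compositions N | (N - k <= head 0 c)%N) F c).
  rewrite -(sum_path_permutations _ (fun c => (N - k <= head 0 c)%N)).
  have first_lengthE (s : 'S_N) : first_length s = head 0%N (shape (cycles s)).
    by rewrite /first_length; case: (cycles s).
  apply: eq_big => [s|s /andP[/in_hess_pathP hs _]]; first by rewrite first_lengthE.
  rewrite /F /= first_lengthE wt_unit_step // expr0 mulr1 -scalerAl.
  by rewrite rmorph_prod /= /shape behead_map big_map.
rewrite sum_compositions_rec; last by apply: leq_ltn_trans ltkN.
(* First parts below [N - k] violate the length condition; the rest are reindexed by their excess
   [i] over [N - k]. *)
rewrite (@big_cat_nat _ _ _ (N - k)) /=; [|by rewrite subn_gt0|by rewrite ltnW // ltnS leq_subr].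
rewrite big_nat_cond big1 ?add0r => [|a]; last first.
  by rewrite andbT => /andP[_ lta]; rewrite big_pred0 // => c; rewrite leqNgt lta.
rewrite -{1}[(N - k)%N]add0n big_addn subSn ?leq_subr // subKn 1?ltnW // big_mkord.
rewrite /path_sum /conv; apply: eq_bigr => i _; rewrite leq_addl /F /= addnK.
rewrite -mulr_sumr; congr (_ * omega_rho_sum _).
by lia.
Qed.

End Recurrence.

(* For k < n the graph P_n itself is used, otherwise any P_N with N > k. *)
Theorem corollary3p12 (n k N : nat) (hn : (1 <= n)%N)
    (hN : if (k < n)%N then N = n else (k < N)%N) :
  e_positive (gsym (@path_hess N) k).
Proof.
have ltkN : (k < N)%N by move: hN; case: ifP => // ltkn ->.
by rewrite gsym_path //; apply: path_sum_e_positive.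
Qed.
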